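(* Let $\mathbf H_1,\dots,\mathbf H_p$ be Hermitian $d\times d$ matrices each with all eigenvalues integers, and with $\max_{i,j}|E^{(l)}_i-E^{(l)}_j|\le\Delta$ for every $l$, where $E^{(l)}_1,\dots,E^{(l)}_d$ are the eigenvalues of $\mathbf H_l$. Let $\mathbf M$ be Hermitian and $\mathcal S$ any dataset, and suppose $L(\cdot;\mathcal S)$ has finitely many critical points within one period. Then within one period $[0,2\pi)^p$, $L(\boldsymbol\theta;\mathcal S)$ has at most $(4\Delta p)^p$ local minima.
   Context: A $p$-parameter QNN is given by Hermitian $\mathbf H_1,\dots,\mathbf H_p$ and Hermitian observable $\mathbf M$; $\mathbf U(\boldsymbol\theta)=e^{-i\theta_p\mathbf H_p}\cdots e^{-i\theta_1\mathbf H_1}$. A dataset is a finite set $\mathcal S=\{(\boldsymbol\rho_i,y_i)\}_{i=1}^m$ of density matrices (PSD, trace 1) and real labels, with loss $L(\boldsymbol\theta;\mathcal S)=\frac1m\sum_i\big(\operatorname{tr}(\mathbf U(\boldsymbol\theta)\boldsymbol\rho_i\mathbf U(\boldsymbol\theta)^\dagger\mathbf M)-y_i\big)^2$. With integer spectra, $L$ is $2\pi$-periodic in each coordinate. *)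

(* Defs.v *)
From HB Require Import structures.
From mathcomp Require Import all_boot all_order all_algebra.
From mathcomp Require Import all_classical all_reals all_analysis.
From mathcomp Require Import complex.
Set Implicit Arguments. Unset Strict Implicit. Unset Printing Implicit Defensive.
Import Order.TTheory GRing.Theory Num.Theory.
Import numFieldNormedType.Exports.
Local Open Scope ring_scope.
Local Open Scope classical_set_scope.

Section QNN.
Variable R : realType.
Local Notation C := (R[i]).

Definition adjmx (m n : nat) (A : 'M[C]_(m, n)) : 'M[C]_(n, m) :=
  (map_mx (@conjc R) A)^T.

Definition is_hermitian (d : nat) (A : 'M[C]_d) : Prop := adjmx A = A.

Definition psd (d : nat) (A : 'M[C]_d) : Prop :=
  is_hermitian A /\ forall v : 'cV[C]_d, 0 <= (adjmx v *m A *m v) 0 0.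

Definition density_matrix (d : nat) (rho : 'M[C]_d) : Prop :=
  psd rho /\ \tr rho = 1.

Definition expm_partial (d : nat) (A : 'M[C]_d) (n : nat) : 'M[C]_d :=
  \sum_(k < n) ((k`!)%:R^-1 : C) *: (\big[mulmx/1%:M]_(j < k) A).

Definition expm (d : nat) (A : 'M[C]_d) : 'M[C]_d :=
  \matrix_(i, j)
    ((lim ((fun n => @complex.Re R (expm_partial A n i j)) @ \oo)) +i*
     (lim ((fun n => @complex.Im R (expm_partial A n i j)) @ \oo)))%C.

Definition evol (d : nat) (theta : R) (H : 'M[C]_d) : 'M[C]_d :=
  expm ((- (theta%:C * 'i))%C *: H).

(* U(theta) = e^{-i theta_p H_p} ... e^{-i theta_1 H_1} (indices 0..p-1) *)
Definition qnnU (d p : nat) (H : 'I_p -> 'M[C]_d) (theta : 'rV[R]_p) : 'M[C]_d :=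
  \big[(fun A B => B *m A)/1%:M]_(k < p) evol (theta 0 k) (H k).

Definition qnn_loss (d p m : nat) (H : 'I_p -> 'M[C]_d) (M : 'M[C]_d)
  (rho : 'I_m -> 'M[C]_d) (y : 'I_m -> R) (theta : 'rV[R]_p) : R :=
  m%:R^-1 * \sum_(i < m)
    (@complex.Re R (\tr (qnnU H theta *m rho i *m adjmx (qnnU H theta) *m M)) - y i) ^+ 2.

Definition in_period (p : nat) (theta : 'rV[R]_p) : Prop :=
  forall k : 'I_p, 0 <= theta 0 k < 2 * pi.

Definition critical_point (p : nat) (f : 'rV[R]_p -> R) (theta : 'rV[R]_p) : Prop :=
  forall k : 'I_p, derivable f theta (delta_mx 0 k) /\ 'D_(delta_mx 0 k) f theta = 0.

Definition local_min (p : nat) (f : 'rV[R]_p -> R) (theta : 'rV[R]_p) : Prop :=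
  \forall x \near theta, f theta <= f x.

End QNN.

(* Main.v *)
Require Import Defs.
From HB Require Import structures.
From mathcomp Require Import all_boot all_order all_algebra.
From mathcomp Require Import all_classical all_reals all_analysis.
From mathcomp Require Import complex.
From mathcomp Require Import zify ring lra.
Import Order.TTheory GRing.Theory Num.Theory.
Import numFieldNormedType.Exports.
Local Open Scope ring_scope.
Local Open Scope classical_set_scope.
(* The loss is a real trigonometric polynomial whose frequencies are at most
   D = 2 Delta in each variable, since every frequency is a difference of two
   eigenvalues, doubled by the square.  As the critical points are finitely many
   modulo the period, each local minimum is strict, hence survives a small
   perturbation.  Perturb by [e * \sum_k cos (K theta_k)] with K = p D + 1: in the
   variables z_k = exp (i theta_k) the critical equations express z_k^K - z_k^-K
   through monomials of smaller total degree, so every monomial reduces to one with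
   exponents in the box [-K, K)^p.  Distinct common zeros give linearly independent
   evaluations of monomials, so there are at most (2 K)^p = (2 p D + 2)^p of them.
   Applying this to theta |-> L (q theta), which has q^p times as many minima and
   degree q D, and letting q grow removes the additive constant:
   the number of minima is at most (2 p D)^p. *)

(** * Characters of the torus and the box bound for common zeros *)

Section Exponentials.
Context {R : realType} {p : nat}.
Local Notation C := (R[i]).
Local Notation freq := {ffun 'I_p -> int}.
Implicit Types (x y : R) (a b c : freq) (theta : 'rV[R]_p).

Definition expi x : C := (cos x +i* sin x)%C.

Lemma expiD x y : expi (x + y) = expi x * expi y.
Proof.
by rewrite /expi cosD sinD; apply/eqP; rewrite eq_complex /= eqxx addrC eqxx.
Qed.

Lemma expi0 : expi 0 = 1.
Proof. by rewrite /expi cos0 sin0. Qed.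

Lemma expiNconj x : expi (- x) = conjc (expi x).
Proof. by rewrite /expi cosN sinN. Qed.

Definition dot a theta : R := \sum_l (a l)%:~R * theta 0 l.

Definition char a theta : C := expi (dot a theta).

Lemma dotD a b theta : dot (a + b) theta = dot a theta + dot b theta.
Proof.
by rewrite /dot -big_split; apply: eq_bigr => l _; rewrite ffunE intrD mulrDl.
Qed.

Lemma dotN a theta : dot (- a) theta = - dot a theta.
Proof.
by rewrite /dot -sumrN; apply: eq_bigr => l _; rewrite ffunE mulrNz mulNr.
Qed.

Lemma dot0 theta : dot 0 theta = 0.
Proof. by rewrite /dot big1// => l _; rewrite ffunE mul0r. Qed.

Lemma charD a b theta : char (a + b) theta = char a theta * char b theta.
Proof. by rewrite /char dotD expiD. Qed.

Lemma char0 theta : char 0 theta = 1.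
Proof. by rewrite /char dot0 expi0. Qed.

Lemma charNconj a theta : char (- a) theta = conjc (char a theta).
Proof. by rewrite /char dotN expiNconj. Qed.

Definition axis (k : 'I_p) (z : int) : freq := [ffun l => if l == k then z else 0].

Lemma dot_axis k z theta : dot (axis k z) theta = z%:~R * theta 0 k.
Proof.
rewrite /dot (bigD1 k)//= ffunE eqxx big1 ?addr0// => l /negPf lk.
by rewrite ffunE lk mul0r.
Qed.

Lemma char_axis k z theta : char (axis k z) theta = expi (z%:~R * theta 0 k).
Proof. by rewrite /char dot_axis. Qed.

(* Each relation rewrites [v a] outside the box into values at frequencies of
   smaller weight [\sum_l `|2 a_l + 1|]; the weight is centred at -1/2 like the box. *)
Lemma recurrence_vanish (D K : nat) (t : 'I_p -> seq (C * freq)) (v : freq -> C) :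
  (p * D < K)%N ->
  (forall k u, u \in t k -> forall l, (absz (u.2 l) <= D)%N) ->
  (forall k a, v (a + axis k K) - v (a - axis k K)
               = \sum_(u <- t k) u.1 * v (a + u.2)) ->
  (forall a, (forall l, - (K%:Z) <= a l < K%:Z) -> v a = 0) ->
  forall a, v a = 0.
Proof.
move=> pDK tD vrec vbox a.
pose w a := (\sum_l absz (2 * a l + 1)%R)%N.
have [n] := ubnP (w a); elim: n a => // n IH a; rewrite ltnS => wa.
have wS (k : 'I_p) b : w b = (absz (2 * b k + 1)%R + \sum_(l | l != k) absz (2 * b l + 1)%R)%N.
  by rewrite /w (bigD1 k).
have waxis (k : 'I_p) z b : w (b + axis k z)
    = (absz (2 * (b k + z) + 1)%R + \sum_(l | l != k) absz (2 * b l + 1)%R)%N.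
  rewrite (wS k) !ffunE eqxx; congr addn; apply: eq_bigr => l /negPf lk.
  by rewrite !ffunE lk addr0.
have wD b (u : freq) : (forall l, (absz (u l) <= D)%N) -> (w (b + u)%R <= w b + 2 * (p * D))%N.
  move=> uD; have -> : (2 * (p * D) = \sum_(l < p) 2 * D)%N.
    by rewrite sum_nat_const card_ord mulnCA.
  rewrite -big_split /=; apply: leq_sum => l _; have := uD l; rewrite ffunE; move: (u l) (b l) => x y xD; lia.
have [abox|] := pselect (forall l, - (K%:Z) <= a l < K%:Z); first exact: vbox.
move=> /existsNP[k] /negP ak.
have axisN z : axis k (- z) = - axis k z.
  by apply/ffunP => l; rewrite !ffunE; case: eqP; rewrite ?oppr0.
(* A term at [b + u.2] weighs at most [w b + 2 * (p * D)], less than [w b + 2 * K]; so a centre [b]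
   lighter than [a] by [2 * K] puts the whole right-hand side under the induction hypothesis. *)
have sum0 b : (w b + 2 * K <= w a)%N -> \sum_(u <- t k) u.1 * v (b + u.2) = 0.
  move=> wb; rewrite big_seq big1// => u ut; rewrite IH ?mulr0//.
  apply: leq_ltn_trans (wD _ _ (tD _ _ ut)) _; apply: leq_trans _ wa.
  move: wb pDK; set x := w b; set y := w a; lia.
(* The relation is centred one step [K] from [a] towards the box, where the weight has dropped by
   exactly [2 * K]. Its far end, two steps away, is strictly lighter than [a] precisely because
   [a k] lies outside [[-K, K)]. *)
have [aK|aK] := leP K%:Z (a k).
- have := vrec k (a - axis k K); rewrite subrK sum0; last first.
    by rewrite -axisN waxis (wS k a); lia.
  rewrite -[a - _ - _]addrA -!axisN.
  have -> : axis k (- K%:Z) + axis k (- K%:Z) = axis k (- K%:Z *+ 2).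
    by apply/ffunP => l; rewrite !ffunE; case: eqP; rewrite ?addr0.
  rewrite [X in _ - X]IH ?subr0// waxis; apply: leq_trans _ wa; rewrite (wS k a); lia.
- have := vrec k (a + axis k K); rewrite addrK sum0; last first.
    by rewrite waxis (wS k a); lia.
  rewrite -[a + _ + _]addrA.
  have -> : axis k K%:Z + axis k K%:Z = axis k (K%:Z *+ 2).
    by apply/ffunP => l; rewrite !ffunE; case: eqP; rewrite ?addr0.
  rewrite IH; first by move/eqP; rewrite sub0r oppr_eq0 => /eqP.
  rewrite waxis; apply: leq_trans _ wa; rewrite (wS k a); lia.
Qed.

(** Points of the torus act as characters of the group of frequencies, and this is Dedekind's
    independence argument. Shifting [a] along the axis [l] and subtracting a multiple of the
    relation multiplies each coefficient by a factor that vanishes at the point [m] but not at [i0];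
    doing so for every [m != i0] isolates [lam i0]. *)
Lemma char_free (I : finType) (th : I -> 'rV[R]_p) (lam : I -> C) :
  (forall i j, i != j -> exists l, expi (th i 0 l) != expi (th j 0 l)) ->
  (forall a, \sum_i lam i * char a (th i) = 0) -> forall i, lam i = 0.
Proof.
move=> sep lam0 i0.
have step (s : seq I) : i0 \notin s -> exists2 f : I -> C, f i0 != 0 &
    (forall j, j \in s -> f j = 0) /\
    (forall a, \sum_i lam i * f i * char a (th i) = 0).
  elim: s => [_|m s IH]; first by exists (fun=> 1); rewrite ?oner_eq0//; split=> // a;
    under eq_bigr do rewrite mulr1.
  rewrite in_cons negb_or => /andP[i0m /IH[f fi0 [fs fa]]].
  have [l hl] := sep _ _ i0m.
  exists (fun i => f i * (expi (th i 0 l) - expi (th m 0 l))).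
    by rewrite mulf_neq0// subr_eq0.
  split=> [j|a].
    by rewrite in_cons => /orP[/eqP->|/fs->]; rewrite ?subrr ?mulr0 ?mul0r.
  transitivity (\sum_i lam i * f i * char (a + axis l 1) (th i)
                - expi (th m 0 l) * \sum_i lam i * f i * char a (th i)).
    rewrite mulr_sumr -sumrB; apply: eq_bigr => i _.
    by rewrite charD char_axis mul1r; ring.
  by rewrite !fa mulr0 subr0.
have [|f fi0 [fs fa]] := step [seq i <- enum I | i != i0].
  by rewrite mem_filter /= eqxx.
have := fa 0; rewrite (bigD1 i0)//= big1 ?addr0 => [|j ji0].
  by move/eqP; rewrite char0 mulr1 mulf_eq0 (negPf fi0) orbF => /eqP.
by rewrite fs ?mulr0 ?mul0r// mem_filter /= ji0 mem_enum.
Qed.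

(** The evaluation matrix of the [(2 * K) ^ p] box monomials at the points has independent rows: a
    relation between rows vanishes on the box, hence at all frequencies by the recurrence, hence is
    trivial by [char_free]. *)
Lemma card_common_zeros (I : finType) (th : I -> 'rV[R]_p) (D K : nat)
    (t : 'I_p -> seq (C * freq)) :
  (p * D < K)%N ->
  (forall i j, i != j -> exists l, expi (th i 0 l) != expi (th j 0 l)) ->
  (forall k u, u \in t k -> forall l, (absz (u.2 l) <= D)%N) ->
  (forall i k, char (axis k K) (th i) - char (- axis k K) (th i)
               = \sum_(u <- t k) u.1 * char u.2 (th i)) ->
  (#|I| <= (2 * K) ^ p)%N.
Proof.
move=> pDK sep tD zero.
pose B := {ffun 'I_p -> 'I_(2 * K)}.
pose e (b : B) : freq := [ffun l => (b l : nat)%:Z - K%:Z].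
pose A : 'M[C]_(#|I|, #|B|) :=
  \matrix_(i, j) char (e (enum_val j)) (th (enum_val i)).
suff /eqP <- : row_free A.
  by apply: leq_trans (rank_leq_col A) _; rewrite card_ffun !card_ord.
apply/row_freeP => //; apply/row_freeP; rewrite -kermx_eq0.
apply/rowV0P => lam /sub_kermxP lamA.
(* [v] extends the row relation [lam] from the box to all frequencies; multiplying the equations
   [zero] by a character turns them into the recurrence for [v]. *)
pose v a := \sum_(i : I) lam 0 (enum_rank i) * char a (th i).
have v0 a : v a = 0.
  apply: recurrence_vanish pDK tD _ _ a => [k a|a abox].
    rewrite /v -sumrB; under eq_bigr => i _.
      rewrite !charD -mulrBr -mulrBr zero !mulr_sumr.
    over.
    rewrite exchange_big /=; apply: eq_bigr => u _.
    rewrite mulr_sumr; apply: eq_bigr => i _; rewrite charD; ring.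
  have b_lt l : (absz (a l + K%:Z)%R < 2 * K)%N by have := abox l; lia.
  pose b : B := [ffun l => Ordinal (b_lt l)].
  have eb : e b = a by apply/ffunP => l; rewrite !ffunE /=; have := abox l; lia.
  have := congr1 (fun N : 'rV[C]_#|B| => N 0 (enum_rank b)) lamA.
  rewrite !mxE => <-; rewrite /v (reindex_onto enum_val enum_rank) /=; last first.
    by move=> i _; rewrite enum_rankK.
  apply: eq_big => [j|j _]; first by rewrite enum_valK eqxx.
  by rewrite !mxE enum_rankK enum_valK eb.
apply/rowP => j; rewrite mxE -(enum_valK j).
exact: (@char_free I th (fun i => lam 0 (enum_rank i)) sep v0).
Qed.

End Exponentials.

(** * Real trigonometric polynomials: derivatives and stability of strict minima *)

Section TrigonometricPolynomials.
Context {R : realType} {p : nat}.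
Local Notation C := (R[i]).
Local Notation freq := {ffun 'I_p -> int}.
Local Notation trigpoly := (seq (C * freq)).
Local Notation Re := (@complex.Re R).
Implicit Types (t : trigpoly) (theta : 'rV[R]_p) (k : 'I_p).

(** Taking real parts makes every list of coefficients and frequencies a real function, with no
    conjugate symmetry to maintain; a frequency may be repeated. *)
Definition tpval t theta : R := \sum_(u <- t) Re (u.1 * char u.2 theta).

Definition tpderiv k t : trigpoly := 
  [seq (u.1 * ((u.2 k)%:~R * 'i%C), u.2) | u : C * freq <- t].

Lemma tpval_cons u t : tpval (u :: t) = (fun theta => Re (u.1 * char u.2 theta)) + tpval t.
Proof. by apply/funext => theta; rewrite /tpval big_cons. Qed.

Lemma Re_mul_expi (z : C) (x : R) :
  Re (z * expi x) = Re z * cos x - complex.Im z * sin x.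
Proof. by case: z. Qed.

Lemma continuous_tpval t : continuous (tpval t : 'rV[R]_p -> R).
Proof.
have cdot (a : freq) : continuous (dot a : 'rV[R]_p -> R).
  rewrite /dot; elim: (index_enum _) => [|l s IH] theta.
    by rewrite (_ : (fun _ => _) = cst 0); [exact: cst_continuous|apply/funext => x; rewrite big_nil].
  rewrite (_ : (fun _ => _) = (fun x : 'rV[R]_p => (a l)%:~R * x 0 l) +
      (fun x : 'rV[R]_p => \sum_(j <- s) (a j)%:~R * x 0 j)); last first.
    by apply/funext => x; rewrite big_cons.
  apply: continuousD; last exact: IH.
  by apply: continuousM; [exact: cst_continuous|exact: coord_continuous].
elim: t => [|u t IH] theta.
  rewrite (_ : tpval [::] = cst 0); first exact: cst_continuous.
  by apply/funext => x; rewrite /tpval big_nil.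
rewrite tpval_cons; apply: continuousD; last exact: IH.
rewrite (_ : (fun _ => _) = (fun x => Re u.1 * cos (dot u.2 x)) -
    (fun x => complex.Im u.1 * sin (dot u.2 x))); last first.
  by apply/funext => x; rewrite /char Re_mul_expi.
apply: continuousB; apply: continuousM; try exact: cst_continuous.
  by apply: continuous_comp; [exact: cdot|exact: continuous_cos].
by apply: continuous_comp; [exact: cdot|exact: continuous_sin].
Qed.

Lemma dot_line (a : freq) k h theta :
  dot a (h *: delta_mx 0 k + theta) = h * (a k)%:~R + dot a theta.
Proof.
rewrite /dot (bigD1 k)//= [in RHS](bigD1 k)//= !mxE !eqxx mulr1 mulrDr addrA mulrC.
congr (_ + _ + _); apply: eq_bigr => l /negPf lk.
by rewrite !mxE lk andbF mulr0 add0r.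
Qed.

Lemma is_derive_line t k theta (h : R) :
  is_derive h (1 : R) (fun h : R => tpval t (h *: delta_mx 0 k + theta))
    (tpval (tpderiv k t) (h *: delta_mx 0 k + theta)).
Proof.
elim: t => [|u t IH].
  rewrite /tpval /= big_nil (_ : (fun h : R => _) = cst 0); first exact: is_derive_cst.
  by apply/funext => x; rewrite big_nil.
rewrite (_ : (fun h : R => _) = (fun h : R => Re (u.1 * char u.2 (h *: delta_mx 0 k + theta)))
   + (fun h : R => tpval t (h *: delta_mx 0 k + theta))); last first.
  by apply/funext => x; rewrite tpval_cons.
rewrite /= tpval_cons; apply: is_deriveD => {IH}/=.
case: u => z a /=; rewrite /char.
pose g h : R := h * (a k)%:~R + dot a theta.
have dg : is_derive h (1 : R) g (a k)%:~R.
  rewrite /g; apply: is_derive_eq; rewrite addr0 scaler0 add0r /=.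
  by rewrite /GRing.scale /= mulr1.
rewrite (_ : (fun h : R => _) = Re z *: (cos \o g) - complex.Im z *: (sin \o g)); last first.
  by apply/funext => x; rewrite Re_mul_expi dot_line.
rewrite dot_line -/(g h).
apply: is_derive_eq.
rewrite /expi; case: z => z1 z2 /=.
rewrite /GRing.scale /=.
have -> : ((a k)%:~R : C) = (((a k)%:~R : R) +i* 0)%C by rewrite -(rmorph_int (real_complex R)).
move: (a k)%:~R => r; rewrite [in RHS]/GRing.mul /=; ring.
Qed.

Lemma derivable_tpval t theta k : derivable (tpval t) theta (delta_mx 0 k) /\
  'D_(delta_mx 0 k) (tpval t) theta = tpval (tpderiv k t) theta.
Proof.
(* The difference quotients in direction [k] are those at 0 of the restriction to the coordinate
   line. *)
have E : (fun h : R => h^-1 *: ((tpval t \o shift theta) (h *: delta_mx 0 k) - tpval t theta))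
       = (fun h : R => h^-1 *: (((fun h : R => tpval t (h *: delta_mx 0 k + theta)) \o shift 0) (h *: 1)
            - tpval t (0 *: delta_mx 0 k + theta))).
  by apply/funext => h /=; rewrite scale0r add0r addr0 [h *: 1]mulr1.
have [d v] := is_derive_line t k theta 0.
split; first by rewrite /derivable E.
by move: v; rewrite scale0r add0r => <-; rewrite /derive E.
Qed.

Lemma local_min_tpderiv t theta k :
  local_min (tpval t) theta -> tpval (tpderiv k t) theta = 0.
Proof.
move=> tmin.
pose line (h : R) : 'rV[R]_p := h *: delta_mx 0 k + theta.
have cl : {for 0, continuous line}.
  apply: continuousD; last exact: cst_continuous.
  exact: scalel_continuous.
have /nbhs_ballP[r /= r0 hr] : \forall h \near (0 : R), tpval t theta <= tpval t (line h).
  have := cl [set x | tpval t theta <= tpval t x].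
  by rewrite /line scale0r add0r; apply.
have [||||_ <-] := @derive1_at_min R (tpval t \o line) (- r) r 0.
- lra.
- by move=> h _; have [] := is_derive_line t k theta h.
- by rewrite in_itv /=; lra.
- move=> h; rewrite in_itv /= => /andP[h1 h2] /=.
  rewrite {1}/line scale0r add0r; apply: hr.
  by rewrite /ball /= sub0r normrN ltr_norml h1 h2.
have [_ ->] := is_derive_line t k theta 0.
by rewrite scale0r add0r.
Qed.

Lemma critical_tpval t theta :
  (forall k, tpval (tpderiv k t) theta = 0) <-> critical_point (tpval t) theta.
Proof.
by split=> h k; have [d v] := derivable_tpval t theta k; [rewrite v|rewrite -v; have [] := h k].
Qed.

(** By compactness [f] exceeds [f theta] by a margin [d] on a small sphere; a perturbation that is
    small against [d] keeps the minimum over the closed ball away from the sphere, so it is a local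
    one. [P] lets the caller confine the new minimum to a prescribed neighbourhood. *)
Lemma strict_min_stable (f : 'rV[R]_p -> R) theta (P : 'rV[R]_p -> Prop) :
  continuous f -> (\forall x \near theta, P x) ->
  (\forall x \near theta, x != theta -> f theta < f x) ->
  exists2 e : R, 0 < e & forall g : 'rV[R]_p -> R, continuous g ->
    (forall x, `|g x| <= e) -> exists2 xi, P xi & local_min (f + g) xi.
Proof.
move=> cf nP nmin.
have /nbhs_normP[r /= r0 hr] : \forall x \near theta, P x /\ (x != theta -> f theta < f x).
  by near=> x; split; near: x.
pose D : set 'rV[R]_p := [set x | `|x - theta| <= r / 2].
pose S : set 'rV[R]_p := [set x | `|x - theta| = r / 2].
have cn : continuous (fun x : 'rV[R]_p => `|x - theta|).
  move=> x; apply: continuous_comp; last exact: norm_continuous.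
  by apply: continuousB; [exact: cvg_id|exact: cst_continuous].
have Dball x : D x -> ball_ Num.norm theta r x.
  by rewrite /D /= distrC => h; lra.
have cD : compact D.
  apply: bounded_closed_compact; last first.
    by apply: (@preimage_closed _ _ _ [set y : R | y <= r / 2]);
       [move=> x _; exact: cn|exact: closed_le].
  exists (r / 2 + `|theta|); split; first exact: num_real.
  move=> M rM x /= Dx; have := ler_normD (x - theta) theta.
  by rewrite subrK; move: Dx rM; rewrite /D /=; lra.
have cS : compact S.
  apply: subclosed_compact cD _; last by move=> x; rewrite /S /D /= => ->.
  by apply: (@preimage_closed _ _ _ [set y : R | y = r / 2]);
       [move=> x _; exact: cn|exact: closed_eq].
have [d d0 hd] : exists2 d : R, 0 < d & forall x, S x -> f theta + d <= f x.
  (* The sphere is empty when [p = 0]; any margin then serves. *)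
  have [S0|/set0P S0] := eqVneq S set0.
    by exists 1 => // x; rewrite S0.
  have [c] := EVT_min_rV S0 cS (continuous_subspaceT cf).
  rewrite inE => Sc cmin; exists (f c - f theta).
    rewrite subr_gt0; apply: (hr c _).2; first by apply: Dball; move: Sc; rewrite /S /D /= => ->.
    by apply/eqP => ct; move: Sc; rewrite /S ct /= subrr normr0; lra.
  by move=> x Sx; rewrite addrC subrK; apply: cmin; rewrite inE.
(* Two values of [g] differ by at most [2 * d / 3], which is below the margin [d]. *)
exists (d / 3) => [|g cg gd]; first by lra.
have cfg : continuous (f + g) by move=> x; apply: continuousD; [exact: cf|exact: cg].
have [|xi] := EVT_min_rV _ cD (continuous_subspaceT cfg).
  by exists theta; rewrite /D /= subrr normr0; lra.
rewrite inE => Dxi ximin; exists xi; first exact: (hr xi (Dball _ Dxi)).1.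
have xi_lt : `|xi - theta| < r / 2.
  rewrite lt_neqAle Dxi andbT; apply/eqP => Sxi.
  have h1 : f xi + g xi <= f theta + g theta.
    by apply: ximin; rewrite inE /D /= subrr normr0 divr_ge0// ltW.
  by have := hd xi Sxi; have := gd xi; have := gd theta; rewrite !ler_norml; lra.
have near_xi : \forall x \near xi, `|x - theta| < r / 2.
  by apply: (cn xi [set y : R | y < r / 2]); apply: open_nbhs_nbhs; split => //; exact: open_lt.
apply: filterS near_xi => x xr.
by apply: ximin; rewrite inE /D /=; exact: ltW.
Unshelve. all: by end_near. Qed.

End TrigonometricPolynomials.

(** * Counting strict minima up to an additive constant, by a cosine perturbation *)

Section CountingMinima.
Context {R : realType} {p : nat}.
Local Notation C := (R[i]).
Local Notation freq := {ffun 'I_p -> int}.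
Local Notation trigpoly := (seq (C * freq)).
Local Notation Re := (@complex.Re R).
Implicit Types (t : trigpoly) (theta : 'rV[R]_p) (k : 'I_p).

Definition torus_neq theta theta' := exists l, expi (theta 0 l) != expi (theta' 0 l).

Definition strict_local_min (f : 'rV[R]_p -> R) theta :=
  \forall x \near theta, x != theta -> f theta < f x.

Definition cosines (e : R) (K : nat) : trigpoly := [seq (e%:C%C, axis k K) | k : 'I_p].

Lemma tpval_cat t t' : tpval (t ++ t') = tpval t + tpval t'.
Proof. by apply/funext => x; rewrite /tpval big_cat. Qed.

Lemma tpval_cosines_le e K theta : 0 <= e -> `|tpval (cosines e K) theta| <= p%:R * e.
Proof.
move=> e0; rewrite /tpval /cosines big_map big_enum /=.
apply: le_trans (ler_norm_sum _ _ _) _.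
rewrite -[p in leRHS]card_ord mulr_natl -sumr_const; apply: ler_sum => k _.
rewrite mul0r subr0 normrM (ger0_norm e0).
by rewrite ler_piMr// cos_max.
Qed.

Lemma tpderiv_cosines e K k theta :
  tpval (tpderiv k (cosines e K)) theta = - (e * K%:R * sin (K%:R * theta 0 k)).
Proof.
rewrite /tpval /tpderiv /cosines 2!big_map big_enum /= (bigD1 k)//= big1 ?addr0 => [|l lk].
  rewrite char_axis Re_mul_expi ffunE eqxx -!pmulrn -(rmorph_nat (real_complex R)).
  have -> : (e%:C * ((K%:R : R)%:C * 'i) = (0 +i* (e * K%:R)))%C.
    by apply/eqP; rewrite eq_complex /=; apply/andP; split; apply/eqP; ring.
  by rewrite mul0r sub0r.
by rewrite ffunE eq_sym (negPf lk) mul0r mulr0 mul0r.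
Qed.

(** Removes the real part from the critical equations, so that they become linear relations between
    characters. *)
Lemma tpval_complex t theta : (2 * tpval t theta)%:C%C =
  \sum_(u <- t) (u.1 * char u.2 theta + conjc u.1 * char (- u.2) theta).
Proof.
have conjD (z : C) : (2 * Re z)%:C%C = z + conjc z.
  by case: z => x y; apply/eqP; rewrite eq_complex /=; apply/andP; split; apply/eqP; ring.
rewrite /tpval mulr_sumr rmorph_sum; apply: eq_bigr => u _.
by rewrite charNconj -[conjc _ * conjc _]rmorphM; exact: conjD.
Qed.

(** Each strict minimum [th i] yields a local minimum [xi i] of the perturbed polynomial. The [xi i]
    stay distinct on the torus, and their critical equations have the shape required by
    [card_common_zeros]. *)
Lemma card_strict_minima_weak (I : finType) (th : I -> 'rV[R]_p) t (D : nat) :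
  (forall i j, i != j -> torus_neq (th i) (th j)) ->
  (forall i, strict_local_min (tpval t) (th i)) ->
  (forall u, u \in t -> forall l, (absz (u.2 l) <= D)%N) ->
  (#|I| <= (2 * (p * D).+1) ^ p)%N.
Proof.
move=> sep smin tD; set K := (p * D).+1.
pose h (b : bool) : R -> R := if b then cos else sin.
have ch b : continuous (h b) by case: b; [exact: continuous_cos|exact: continuous_sin].
(* Where the cosines or sines at [th i] and [th j] differ, [x] stays within half their distance from
   [th i]; this will keep [xi i] and [xi j] apart. *)
pose Q i j b l (x : 'rV[R]_p) := h b (th i 0 l) != h b (th j 0 l) ->
  `|h b (th i 0 l) - h b (x 0 l)| < `|h b (th i 0 l) - h b (th j 0 l)| / 2.
pose P i x := forall j b l, Q i j b l x.
have nP i : \forall x \near th i, P i x.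
  apply: (@filter_forall _ I (fun j x => forall b l, Q i j b l x) (nbhs (th i)) _) => j.
  apply: (@filter_forall _ bool (fun b x => forall l, Q i j b l x) (nbhs (th i)) _) => b.
  apply: (@filter_forall _ 'I_p (fun l x => Q i j b l x) (nbhs (th i)) _) => l; rewrite /Q.
  have [->|ne] := eqVneq (h b (th i 0 l)) (h b (th j 0 l)); first exact: filterE.
  have cc : {for th i, continuous (fun x : 'rV[R]_p => h b (x 0 l))}.
    by apply: continuous_comp; [exact: coord_continuous|exact: ch].
  move/cvgrPdist_lt: cc => /(_ (`|h b (th i 0 l) - h b (th j 0 l)| / 2)) H.
  apply: filterS (H _) => [x ? _ //|]; by rewrite divr_gt0// normr_gt0 subr_eq0.
have /choice[d hd] : forall i, exists d, 0 < d /\ forall g : 'rV[R]_p -> R, continuous g ->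
    (forall x, `|g x| <= d) -> exists2 xi, P i xi & local_min (tpval t + g) xi.
  move=> i; have [d d0 H] := @strict_min_stable R p _ _ _ (@continuous_tpval R p t) (nP i) (smin i).
  by exists d.
(* One perturbation must suit all minima at once; the default 1 covers an empty [I]. *)
pose m : R := \big[Num.min/1]_i d i.
have m0 : 0 < m by rewrite lt_bigmin ?ltr01// => i _; have [] := hd i.
(* The cosine sum is bounded by [p * e]; dividing by [p.+1] also allows [p = 0]. *)
pose e : R := m / p.+1%:R.
have e0 : 0 < e by rewrite divr_gt0 ?ltr0n.
have ed i : p%:R * e <= d i.
  apply: (@le_trans _ _ m); last exact: bigmin_le.
  rewrite /e mulrCA ler_piMr ?ler_pdivrMr ?ltr0n// ?mul1r ?ler_nat//; exact: ltW.
have /choice[xi hxi] : forall i, exists xi, P i xi /\ local_min (tpval (t ++ cosines e K)) xi.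
  move=> i; rewrite tpval_cat; have [_ H] := hd i.
  have [|x|xi Pxi xmin] := H (tpval (cosines e K)); first exact: continuous_tpval.
    by apply: le_trans (ed i); apply: tpval_cosines_le; exact: ltW.
  by exists xi.
(* The critical equation reads [e K sin (K theta_k)] = derivative of [t], and
   [char (axis k K) - char (- axis k K)] is [2 i sin (K theta_k)]: hence the factor [i / (e K)] on
   twice the derivative. *)
pose c : C := (0 +i* (e * K%:R)^-1)%C.
pose s k := flatten [seq [:: (c * u.1, u.2); (c * conjc u.1, - u.2)] | u : C * freq <- tpderiv k t].
have eK : e * K%:R != 0 by rewrite mulf_neq0 ?pnatr_eq0// gt_eqF.
apply: (@card_common_zeros R p I xi D K s) => //.
- move=> i j /sep[l hl]; exists l; apply: contraNN hl => /eqP [cE sE].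
  (* A common value at [xi i] and [xi j] would lie within half the distance of both original values,
     against the triangle inequality. *)
  have key b : h b (th i 0 l) = h b (th j 0 l).
    have {cE sE} hE : h b (xi i 0 l) = h b (xi j 0 l) by case: b.
    apply/eqP/contraT => ne.
    have := (hxi i).1 j b l ne; have := (hxi j).1 i b l; rewrite /Q eq_sym ne => /(_ isT).
    rewrite -hE => h1 h2; have := ler_distD (h b (xi i 0 l)) (h b (th i 0 l)) (h b (th j 0 l)).
    rewrite [X in _ <= _ + X]distrC; rewrite (distrC (h b (th j 0 l)) (h b (th i 0 l))) in h1; lra.
  by apply/eqP; rewrite /expi (key true : cos _ = cos _) (key false : sin _ = sin _).
- move=> k u /flattenP[_ /mapP[v /mapP[w wt ->] ->]] /=.
  by rewrite !inE => /orP[]/eqP-> l /=; rewrite ?ffunE ?abszN; exact: tD.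
- move=> i k; have := local_min_tpderiv _ _ k (hxi i).2.
  rewrite /tpderiv map_cat -/(tpderiv _ _) -/(tpderiv _ _) tpval_cat.
  rewrite [(_ + _) _]/(_ + _) tpderiv_cosines => /eqP; rewrite subr_eq0 => /eqP tz.
  rewrite /s big_flatten big_map /=.
  transitivity (c * (2 * tpval (tpderiv k t) (xi i))%:C%C).
    rewrite tz charNconj char_axis -pmulrn /expi.
    move: (sin _) (cos _) => x y; apply/eqP; rewrite eq_complex /=.
    by apply/andP; split; apply/eqP; [|rewrite [_^-1 * _]mulrCA mulKf//]; ring.
  rewrite tpval_complex mulr_sumr; apply: eq_bigr => u _.
  by rewrite !big_cons big_nil addr0 /= mulrDr !mulrA.
Qed.

End CountingMinima.

(** * Arithmetic of the dilation argument *)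

Lemma leq_expn_add (a b n : nat) : ((a + b) ^ n <= a ^ n + n * b * (a + b) ^ n.-1)%N.
Proof.
case: n => [|n] //=; elim: n => [|n IH]; first by rewrite !expn1 expn0; lia.
have h : (a * (a + b) ^ n <= (a + b) ^ n.+1)%N by rewrite expnS leq_mul2r leq_addr orbT.
have := leq_mul (leqnn a) IH; have := leq_mul (leqnn (n.+1 * b)) h.
rewrite /= (expnS (a + b) n.+1) (expnS a n.+1).
by move: ((a + b) ^ n.+1)%N ((a + b) ^ n)%N (a ^ n.+1)%N => A B E; nia.
Qed.

(* Rescaling trick: the additive constant 2 is washed out as q grows. *)
Lemma leq_exp_of_dilations (N X p : nat) :
  (forall q, (0 < q)%N -> (N * q ^ p <= (q * X + 2) ^ p)%N) -> (N <= X ^ p)%N.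
Proof.
case: p => [|p] H; first by have := H 1%N isT; rewrite !expn0 muln1.
rewrite leqNgt; apply/negP => NX.
(* By the mean value estimate [leq_expn_add], the constant 2 costs at most [M * q ^ p], whereas
   [N > X ^ p.+1] gains at least [q ^ p.+1]; any [q > M] decides. *)
pose M := (2 * p.+1 * (X + 2) ^ p)%N; pose q := M.+1.
have := H q isT; apply/negP; rewrite -ltnNge.
apply: leq_ltn_trans (leq_expn_add _ _ _) _; rewrite /= expnMn.
have h1 : ((q * X + 2) ^ p <= q ^ p * (X + 2) ^ p)%N.
  rewrite -expnMn; case: (p) => // n.
  by rewrite leq_exp2r// mulnDr leq_add2l -{1}[2%N]mul1n leq_mul2r orbT.
apply: (@leq_ltn_trans (q ^ p.+1 * X ^ p.+1 + M * q ^ p)%N).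
  rewrite leq_add2l /M; move: h1; move: (_ ^ p)%N (q ^ p)%N ((X + 2) ^ p)%N => A B E; nia.
have h2 : (M * q ^ p < q ^ p.+1)%N by rewrite expnS ltn_pmul2r ?expn_gt0.
by move: NX h2; move: (X ^ _)%N (q ^ p.+1)%N (M * _)%N => A B E; nia.
Qed.

(** * Periodicity, strictness of minima, and the count without additive constant *)

Section Periodicity.
Context {R : realType} {p : nat}.
Local Notation C := (R[i]).
Local Notation freq := {ffun 'I_p -> int}.
Local Notation trigpoly := (seq (C * freq)).
Implicit Types (t : trigpoly) (theta : 'rV[R]_p) (k : 'I_p).

Lemma expi_period (x : R) (z : int) : expi (x + 2 * pi * z%:~R) = expi x.
Proof.
have expi_nat y (n : nat) : expi (y + 2 * pi * n%:R) = expi y :> C.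
  have e : 2 * pi * n%:R = (pi *+ 2) *+ n :> R by rewrite -[RHS]mulr_natr -(mulr_natl pi 2).
  by rewrite /expi e (periodicn (@cosD2pi R)) (periodicn (@sinD2pi R)).
case: z => n; first exact: expi_nat.
by rewrite NegzE mulrNz mulrN -[in RHS](subrK (2 * pi * n.+1%:R) x) expi_nat.
Qed.

(** By the half-angle formula [sin (z / 2)] would vanish, but sine is positive strictly between 0
    and [pi]. *)
Lemma cos_eq1 (z : R) : cos z = 1 -> `|z| < 2 * pi -> z = 0.
Proof.
rewrite -cos_norm => cz zpi; apply/eqP; rewrite -normr_eq0; apply/negPn/negP => z0.
have := sin_gt0_pi (x := `|z| / 2); rewrite divr_gt0 ?normr_gt0 ?ltr_pdivrMr//=; last by rewrite -normr_eq0.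
rewrite (mulrC pi) zpi => /(_ isT) s0.
have : cos (`|z| / 2 *+ 2) = 1 by rewrite -[RHS]cz -mulr_natr divfK ?pnatr_eq0.
by rewrite cos_mulr2n cos2sin2; nra.
Qed.

Lemma expi_inj_near (x y : R) : expi x = expi y -> `|x - y| < 2 * pi -> x = y.
Proof.
case=> cxy sxy xy; apply/eqP; rewrite -subr_eq0; apply/eqP; apply: cos_eq1 xy.
by rewrite cosB cxy sxy -!expr2 cos2Dsin2.
Qed.

Lemma char_period a theta (v : 'I_p -> int) :
  char a (theta + \row_l (2 * pi * (v l)%:~R)) = char a theta.
Proof.
rewrite /char.
have -> : dot a (theta + \row_l (2 * pi * (v l)%:~R))
          = dot a theta + 2 * pi * (\sum_l a l * v l)%:~R.
  rewrite /dot (rmorph_sum (intr : int -> R)) mulr_sumr -big_split; apply: eq_bigr => l _ /=.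
  by rewrite !mxE rmorphM /=; ring.
by rewrite expi_period.
Qed.

Lemma tpval_period t theta (v : 'I_p -> int) :
  tpval t (theta + \row_l (2 * pi * (v l)%:~R)) = tpval t theta.
Proof. by apply: eq_bigr => u _; rewrite char_period. Qed.

Lemma exists_in_period theta : exists v : 'I_p -> int,
  in_period (theta + \row_l (2 * pi * (v l)%:~R)).
Proof.
exists (fun l => - Num.floor (theta 0 l / (2 * pi))) => l; rewrite !mxE.
have pi0 : 0 < 2 * pi :> R by rewrite mulr_gt0 ?pi_gt0.
have /andP[] := floor_itv (theta 0 l / (2 * pi)).
rewrite ler_pdivlMr// ltr_pdivrMr// intrD rmorphN /=; lra.
Qed.

Lemma in_period_dist theta theta' l : in_period theta -> in_period theta' ->
  `|theta 0 l - theta' 0 l| < 2 * pi.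
Proof. by move=> /(_ l) h /(_ l) h'; rewrite ltr_norml; lra. Qed.

Lemma in_period_torus_neq theta theta' : in_period theta -> in_period theta' ->
  theta != theta' -> torus_neq theta theta'.
Proof.
move=> h h' ne; apply: contrapT => /forallNP eqe; move/eqP: ne; apply.
apply/rowP => l; apply: expi_inj_near; last exact: in_period_dist.
by apply/eqP/negPn/negP; exact: eqe.
Qed.

Lemma near_torus_neq theta theta' :
  torus_neq theta theta' -> \forall x \near theta, torus_neq x theta'.
Proof.
move=> [l]; rewrite /expi eq_complex negb_and => /orP[] /= ne.
- have cc : {for theta, continuous (fun x : 'rV[R]_p => cos (x 0 l))}.
    by apply: continuous_comp; [exact: coord_continuous|exact: continuous_cos].
  have H : \forall x \near theta, cos ((x : 'rV[R]_p) 0 l) != cos (theta' 0 l).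
    exact: (cc [set y | y != cos (theta' 0 l)] (open_nbhs_nbhs (conj (@open_neq _ _) ne))).
  by apply: filterS H => x /= nx; exists l; rewrite /expi eq_complex negb_and nx.
- have cc : {for theta, continuous (fun x : 'rV[R]_p => sin (x 0 l))}.
    by apply: continuous_comp; [exact: coord_continuous|exact: continuous_sin].
  have H : \forall x \near theta, sin ((x : 'rV[R]_p) 0 l) != sin (theta' 0 l).
    exact: (cc [set y | y != sin (theta' 0 l)] (open_nbhs_nbhs (conj (@open_neq _ _) ne))).
  by apply: filterS H => x /= nx; exists l; rewrite /expi eq_complex negb_and nx orbT.
Qed.

(* Near a local minimum every point with the same value is a local minimum too,
   hence critical, and modulo the period there are only finitely many of those. *)
Lemma finite_critical_strict t theta :
  finite_set [set x : 'rV[R]_p | in_period x /\ critical_point (tpval t) x] ->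
  in_period theta -> local_min (tpval t) theta -> strict_local_min (tpval t) theta.
Proof.
move=> /finite_seqP[s crit_s] per tmin.
(* Being apart on the torus from a point is an open condition, so it holds near [theta] for all the
   finitely many other critical points together. *)
have near_sub (s' : seq 'rV[R]_p) : {subset s' <= s} ->
    \forall x \near theta, forall c, c \in s' -> c != theta -> torus_neq x c.
  elim: s' => [_|c s' IH sub]; first exact: filterE.
  have nc : \forall x \near theta, c != theta -> torus_neq x c.
    have [->|ne] := eqVneq c theta; first exact: filterE.
    have pc : in_period c.
      have : [set` s] c by rewrite /= sub// mem_head.
      by rewrite -crit_s => -[].
    have nct : torus_neq theta c by apply: in_period_torus_neq => //; rewrite eq_sym.
    by apply: filterS (near_torus_neq _ _ nct).
  have {}IH := IH (fun x xs => sub x (mem_behead (s := c :: s') xs)).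
  apply: filterS2 nc IH => x xc xs d.
  by rewrite in_cons => /orP[/eqP->|]; [exact: xc|exact: xs].
have near_s := near_sub s (fun _ => id).
have near_dist : \forall x \near theta, forall l, `|(x : 'rV[R]_p) 0 l - theta 0 l| < 2 * pi.
  apply: (@filter_forall _ 'I_p (fun l x => `|x 0 l - theta 0 l| < 2 * pi) (nbhs theta) _) => l.
  have /cvgrPdist_lt cc : {for theta, continuous (fun x : 'rV[R]_p => x 0 l)}.
    exact: coord_continuous.
  have pi0 : 0 < 2 * pi :> R by rewrite mulr_gt0 ?pi_gt0.
  by apply: filterS (cc _ pi0) => x; rewrite distrC.
have near_min := nbhs_interior tmin.
have near_le : \forall x \near theta, tpval t theta <= tpval t x by [].
apply: filterS3 near_s near_dist (filterI near_min near_le) => x xs xd [xmin xle] ne.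
rewrite lt_neqAle xle andbT; apply: contraNN ne => /eqP xeq.
have cx : local_min (tpval t) x by apply: filterS xmin => z; rewrite /= xeq.
(* [x] may have left the period, so its translate [x'] is looked up in the finite list; not being
   apart from [x], it can only be [theta]. *)
have [v pv] := exists_in_period x; set x' := x + _ in pv.
have x's : x' \in s.
  have : [set` s] x'; last by [].
  rewrite -crit_s; split=> //; apply/critical_tpval => k.
  by rewrite tpval_period; apply: local_min_tpderiv.
have ex l : expi (x 0 l) = expi (x' 0 l) by rewrite !mxE expi_period.
have [x't|x't] := eqVneq x' theta; last first.
  by have [l] := xs _ x's x't; rewrite ex eqxx.
apply/eqP/rowP => l; apply: expi_inj_near (xd l).
by rewrite ex x't.
Qed.

Lemma tpval_dilate t q theta :
  tpval [seq (u.1, [ffun l => q%:Z * u.2 l]) | u : C * freq <- t] theta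
  = tpval t (q%:R *: theta).
Proof.
rewrite /tpval big_map; apply: eq_bigr => u _; congr (complex.Re (_ * expi _)).
by apply: eq_bigr => l _; rewrite ffunE mxE rmorphM /= -pmulrn; ring.
Qed.

(** Under multiplication by [q] each strict minimum has [q ^ p] preimages in the period, all strict
    minima of the dilated polynomial of degree [q * D], to which the weak count applies. *)
Lemma card_strict_minima (I : finType) (th : I -> 'rV[R]_p) t (D : nat) :
  injective th -> (forall i, in_period (th i)) ->
  (forall i, strict_local_min (tpval t) (th i)) ->
  (forall u, u \in t -> forall l, (absz (u.2 l) <= D)%N) ->
  (#|I| <= (2 * p * D) ^ p)%N.
Proof.
move=> th_inj th_per smin tD; apply: leq_exp_of_dilations => q q0.
have q0R : 0 < q%:R :> R by rewrite ltr0n.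
have pi0 : 0 < 2 * pi :> R by rewrite mulr_gt0 ?pi_gt0.
pose shift (v : {ffun 'I_p -> 'I_q}) : 'rV[R]_p := \row_l (2 * pi * (v l : nat)%:~R).
pose xi (iv : I * {ffun 'I_p -> 'I_q}) : 'rV[R]_p := q%:R^-1 *: (th iv.1 + shift iv.2).
have xi_per iv : in_period (xi iv).
  move=> l; rewrite !mxE mulrC -pmulrn.
  have /andP[h1 h2] := th_per iv.1 l.
  rewrite divr_ge0 ?ler0n ?addr_ge0 ?mulr_ge0 ?ler0n ?pi_ge0//= ltr_pdivrMr//.
  have : ((iv.2 l).+1%:R : R) <= q%:R by rewrite ler_nat.
  rewrite -natr1; move: ((iv.2 l)%:R : R) => b.
  by nra.
have xi_inj : injective xi.
  move=> [i v] [j w] /(congr1 (fun x => q%:R *: x)); rewrite !scalerA divff ?gt_eqF// !scale1r.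
  move=> /rowP e.
  (* [th i] and [th j] lie in one period, so their difference, an integer multiple of [2 * pi] in
     each coordinate, is zero. *)
  have vw : v = w.
    apply/ffunP => l; have := e l; rewrite !mxE /= => el; apply: val_inj => /=.
    have := in_period_dist _ _ l (th_per i) (th_per j).
    have -> : th i 0 l - th j 0 l = 2 * pi * ((w l : nat)%:Z - (v l : nat)%:Z)%:~R.
      rewrite intrB; move: el; lra.
    rewrite normrM gtr0_norm// -{2}[2 * pi]mulr1 ltr_pM2l// -intr_norm ltrz1.
    lia.
  move: e; rewrite vw => e; congr (_, _); apply: th_inj; apply/rowP => l.
  by have := e l; rewrite !mxE => /addIr.
rewrite -[p in (q ^ p)%N]card_ord -[q in (q ^ _)%N]card_ord -card_ffun -card_prod.
have -> : (q * (2 * p * D) + 2 = 2 * (p * (q * D)).+1)%N by lia.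
apply: (@card_strict_minima_weak R p _ xi
  [seq (u.1, [ffun l => q%:Z * u.2 l]) | u : C * freq <- t]).
- by move=> iv jw ne; apply: in_period_torus_neq => //; rewrite (inj_eq xi_inj).
- move=> [i v].
  (* Subtracting the period vector [shift v] leaves the values unchanged and sends [xi (i, v)] to
     [th i] itself, whose strictness pulls back along the injective continuous [g]. *)
  pose g (x : 'rV[R]_p) := q%:R *: x - shift v.
  have gxi : g (xi (i, v)) = th i.
    by rewrite /g /xi scalerA divff ?gt_eqF// scale1r addrK.
  have fg x : tpval t (q%:R *: x) = tpval t (g x).
    rewrite -[in LHS](subrK (shift v) (q%:R *: x)).
    exact: (tpval_period t (g x) (fun l => (v l : nat)%:Z)).
  have cg : {for xi (i, v), continuous g}.
    by apply: continuousB; [exact: scaler_continuous|exact: cst_continuous].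
  have near_xi : \forall x \near xi (i, v), g x != th i -> tpval t (th i) < tpval t (g x).
    by apply: (cg [set y | y != th i -> tpval t (th i) < tpval t y]); rewrite gxi; exact: smin.
  apply: filterS near_xi => x /= H ne.
  rewrite !tpval_dilate !fg gxi; apply: H; apply: contraNN ne => /eqP gx.
  apply/eqP; apply: (scalerI (lt0r_neq0 q0R)); apply: (@addIr _ (- shift v)).
  by rewrite -[LHS]/(g x) gx -gxi.
- move=> _ /mapP[u ut ->] l; rewrite ffunE abszM /= leq_mul2l tD ?orbT//.
Qed.

End Periodicity.

(** * Exponentials of diagonalizable matrices and the evolution operators *)

Section QuantumCircuit.
Context {R : realType}.
Local Notation C := (R[i]).
Local Notation Re := (@complex.Re R).
Local Notation Im := (@complex.Im R).

Lemma expi_term (x : R) k :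
  (k`!%:R)^-1 * (0 +i* x)%C ^+ k = (cos_coeff x k +i* sin_coeff x k)%C.
Proof.
have even m : (0 +i* x)%C ^+ m.*2 = ((-1) ^+ m * x ^+ m.*2)%:C%C :> C.
  rewrite -mul2n !exprM -exprMn; have -> : (0 +i* x)%C ^+ 2 = (-1 * x ^+ 2)%:C%C :> C.
    by apply/eqP; rewrite expr2 eq_complex /=; apply/andP; split; apply/eqP; ring.
  by rewrite rmorphXn.
have -> : (k`!%:R)^-1 = ((k`!%:R)^-1 : R)%:C%C :> C by rewrite fmorphV rmorph_nat.
rewrite -(odd_double_half k); case: (odd k) (k./2) => m.
  rewrite add1n exprS even /cos_coeff /sin_coeff /= odd_double doubleK exprS.
  by apply/eqP; rewrite eq_complex /=; apply/andP; split; apply/eqP; ring.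
rewrite add0n even /cos_coeff /sin_coeff /= odd_double doubleK -exprnP.
by apply/eqP; rewrite eq_complex /=; apply/andP; split; apply/eqP; ring.
Qed.

Lemma expi_partial (x : R) n :
  \sum_(k < n) (k`!%:R)^-1 * (0 +i* x)%C ^+ k =
  (series (cos_coeff x) n +i* series (sin_coeff x) n)%C.
Proof.
elim: n => [|n IH]; first by rewrite big_ord0 /series /= !big_geq.
rewrite big_ord_recr IH expi_term /= !seriesSr //.
Qed.

Lemma mul_big_mulmx d (A : 'M[C]_d) (P : 'M[C]_d) (D : 'rV[C]_d) k :
  P \in unitmx -> A = invmx P *m diag_mx D *m P ->
  \big[mulmx/1%:M]_(j < k) A = invmx P *m diag_mx (\row_l D 0 l ^+ k) *m P.
Proof.
move=> uP AE; elim: k => [|k IH].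
  rewrite big_ord0 (_ : diag_mx _ = 1%:M) ?mulmx1 ?mulVmx//.
  by rewrite -diag_const_mx; congr diag_mx; apply/rowP => l; rewrite !mxE.
rewrite big_ord_recl IH {1}AE -!mulmxA mulKVmx//; congr (_ *m _); rewrite !mulmxA; congr (_ *m _).
by rewrite mulmx_diag; congr diag_mx; apply/rowP => l; rewrite !mxE exprS.
Qed.

Lemma hermitian_normal d (A : 'M[C]_d) : is_hermitian A -> A \is normalmx.
Proof.
move=> hA; apply/normalmxP; suff -> : map_mx Num.conj A^T = A by [].
by rewrite -[RHS]hA; apply/matrixP => i j; rewrite !mxE.
Qed.

(** Each entry of a partial sum is a fixed linear combination of scalar partial sums, so its real
    and imaginary parts converge with the cosine and sine series. *)
Lemma expm_diagonalizable d (A P : 'M[C]_d) (x : 'I_d -> R) :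
  P \in unitmx -> A = invmx P *m diag_mx (\row_l (0 +i* x l)%C) *m P ->
  forall i j, expm A i j = \sum_l invmx P i l * P l j * expi (x l).
Proof.
move=> uP AE i j.
pose c l : C := invmx P i l * P l j.
have partialE n : expm_partial A n i j =
    \sum_l c l * (series (cos_coeff (x l)) n +i* series (sin_coeff (x l)) n)%C.
  rewrite /expm_partial summxE.
  under eq_bigr => k _.
    rewrite mxE (mul_big_mulmx _ _ _ _ _ uP AE) mul_mx_diag mxE mulr_sumr.
    under eq_bigr do rewrite !mxE.
  over.
  rewrite exchange_big; apply: eq_bigr => l _; rewrite -expi_partial mulr_sumr.
  by apply: eq_bigr => k _; rewrite /c; ring.
have cvgC l : series (cos_coeff (x l)) n @[n --> \oo] --> cos (x l).
  by rewrite unlock; exact: is_cvg_series_cos_coeff.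
have cvgS l : series (sin_coeff (x l)) n @[n --> \oo] --> sin (x l).
  by rewrite unlock; exact: is_cvg_series_sin_coeff.
have cvg_lin (a b : 'I_d -> R) :
    \sum_l (a l * series (cos_coeff (x l)) n + b l * series (sin_coeff (x l)) n) @[n --> \oo]
    --> \sum_l (a l * cos (x l) + b l * sin (x l)).
  by apply: cvg_big => [|l _]; [exact: add_continuous|apply: cvgD; apply: cvgMr].
have Re_sum (F : 'I_d -> C) : Re (\sum_l F l) = \sum_l Re (F l).
  by apply: (big_morph _ (id1 := 0) (op1 := +%R)) => // -[? ?] [? ?].
have Im_sum (F : 'I_d -> C) : Im (\sum_l F l) = \sum_l Im (F l).
  by apply: (big_morph _ (id1 := 0) (op1 := +%R)) => // -[? ?] [? ?].
rewrite mxE; apply/eqP; rewrite eq_complex /=; apply/andP; split; apply/eqP.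
- rewrite (_ : Re _ = \sum_l (Re (c l) * cos (x l) + - Im (c l) * sin (x l))); last first.
    by rewrite Re_sum; apply: eq_bigr => l _; rewrite Re_mul_expi mulNr.
  apply: cvg_lim => //; rewrite [X in X @ _](_ : _ = fun n => \sum_l (Re (c l) *
      series (cos_coeff (x l)) n + - Im (c l) * series (sin_coeff (x l)) n)); first exact: cvg_lin.
  apply/funext => n; rewrite partialE Re_sum; apply: eq_bigr => l _.
  by case: (c l) => a b /=; rewrite mulNr.
- rewrite (_ : Im _ = \sum_l (Im (c l) * cos (x l) + Re (c l) * sin (x l))); last first.
    rewrite Im_sum; apply: eq_bigr => l _; rewrite -/(c l).
    by case: (c l) => a b /=; rewrite addrC.
  apply: cvg_lim => //; rewrite [X in X @ _](_ : _ = fun n => \sum_l (Im (c l) *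
      series (cos_coeff (x l)) n + Re (c l) * series (sin_coeff (x l)) n)); first exact: cvg_lin.
  apply/funext => n; rewrite partialE Im_sum; apply: eq_bigr => l _.
  by case: (c l) => a b /=; rewrite addrC.
Qed.

Lemma evolE d (H : 'M[C]_d) :
  is_hermitian H -> (forall a, eigenvalue H a -> exists z : int, a = z%:~R) ->
  exists (z : 'I_d -> int) (c : 'I_d -> 'I_d -> 'I_d -> C),
    (forall l, eigenvalue H (z l)%:~R) /\
    forall x i j, evol x H i j = \sum_l c i j l * expi ((- z l)%:~R * x).
Proof.
move=> hH intH.
have /orthomx_spectralP HE := hermitian_normal _ _ hH.
set P := spectralmx H in HE; set sp := spectral_diag H in HE.
have uP : P \in unitmx by exact: spectral_unit.
(* Eigenvectors are row vectors here: [H = invmx P *m diag_mx sp *m P] makes row [l] of [P] one, and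
   it is nonzero because [P] is invertible. *)
have eig l : eigenvalue H (sp 0 l).
  apply/eigenvalueP; exists (row l P).
    rewrite {1}HE -row_mul !mulmxA mulmxV// mul1mx row_mul row_diag_mx.
    by rewrite -scalemxAl -rowE.
  apply/eqP => P0; have := row_free_unit P; rewrite uP => /row_freeP[B PB].
  have := congr1 (mulmx^~ B) P0; rewrite -row_mul PB mul0mx => /rowP/(_ l)/eqP.
  by rewrite !mxE eqxx oner_eq0.
have /choice[z zE] : forall l, exists z : int, sp 0 l = z%:~R by move=> l; exact: intH.
exists z, (fun i j l => invmx P i l * P l j); split=> [l|x i j]; first by rewrite -zE.
apply: (expm_diagonalizable _ _ P (fun l => (- z l)%:~R * x) uP).
have -> : diag_mx (\row_l (0 +i* ((- z l)%:~R * x)))%C = (- (x%:C * 'i))%C *: diag_mx sp.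
  apply/matrixP => a b; rewrite !mxE mulrnAr; congr (_ *+ _).
  rewrite zE -(rmorph_int (real_complex R)); apply/eqP; rewrite eq_complex /= rmorphN /=.
  by apply/andP; split; apply/eqP; ring.
by rewrite -scalemxAr -scalemxAl -HE.
Qed.

End QuantumCircuit.

(** * The loss as a trigonometric polynomial of controlled degree *)

Section LossIsTrigonometric.
Context {R : realType} {p : nat}.
Local Notation C := (R[i]).
Local Notation freq := {ffun 'I_p -> int}.
Local Notation trigpoly := (seq (C * freq)).
Implicit Types (P Q S : freq -> Prop) (F G : 'rV[R]_p -> C).

(** A predicate on frequencies is kept instead of a degree, because the frequencies of the circuit
    are themselves not bounded by the spectral gap; only their differences are. *)
Definition spectrum_in P F := exists2 t : trigpoly,
  (forall u, u \in t -> P u.2) &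
  forall theta, F theta = \sum_(u <- t) u.1 * char u.2 theta.

Definition degree_le (D : nat) (a : freq) : Prop := forall l, (absz (a l) <= D)%N.

Lemma spectrum_ext P F G : F =1 G -> spectrum_in P F -> spectrum_in P G.
Proof. by move=> FG [t tP tF]; exists t => // theta; rewrite -FG. Qed.

Lemma spectrum_char P (z : C) a : P a -> spectrum_in P (fun theta => z * char a theta).
Proof.
move=> Pa; exists [:: (z, a)]; first by move=> u; rewrite inE => /eqP->.
by move=> theta; rewrite big_cons big_nil addr0.
Qed.

Lemma spectrum_cst P (z : C) : P 0 -> spectrum_in P (fun=> z).
Proof.
move=> P0; apply: spectrum_ext (spectrum_char P z 0 P0) => theta.
by rewrite char0 mulr1.
Qed.

Lemma spectrum_sub P Q F : (forall a, P a -> Q a) -> spectrum_in P F -> spectrum_in Q F.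
Proof. by move=> PQ [t tP tF]; exists t => // u /tP/PQ. Qed.

Lemma spectrum_sum (I : Type) (r : seq I) P (F : I -> 'rV[R]_p -> C) :
  (forall i, spectrum_in P (F i)) -> spectrum_in P (fun theta => \sum_(i <- r) F i theta).
Proof.
move=> HF; elim: r => [|i r [t tP tF]].
  by exists [::] => // theta; rewrite !big_nil.
have [s sP sF] := HF i; exists (s ++ t) => [u|theta].
  by rewrite mem_cat => /orP[/sP|/tP].
by rewrite big_cons big_cat sF tF.
Qed.

Lemma spectrum_mul P Q S F G : (forall a b, P a -> Q b -> S (a + b)) ->
  spectrum_in P F -> spectrum_in Q G -> spectrum_in S (fun theta => F theta * G theta).
Proof.
move=> PQS [t tP tF] [s sQ sG].
exists [seq (u.1 * w.1, u.2 + w.2) | u <- t, w <- s] => [x|theta].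
  by move=> /allpairsP[[u w] [/tP Pu /sQ Qw ->]]; exact: PQS.
rewrite tF sG big_allpairs_dep mulr_suml; apply: eq_bigr => u _.
by rewrite mulr_sumr; apply: eq_bigr => w _; rewrite charD /=; ring.
Qed.

Lemma spectrum_conj P Q F : (forall a, P a -> Q (- a)) ->
  spectrum_in P F -> spectrum_in Q (fun theta => conjc (F theta)).
Proof.
move=> PQ [t tP tF]; exists [seq (conjc u.1, - u.2) | u : C * freq <- t].
  by move=> _ /mapP[u /tP/PQ Qu ->].
move=> theta; rewrite tF rmorph_sum big_map; apply: eq_bigr => u _.
by rewrite charNconj rmorphM.
Qed.

Lemma spectrum_real P F : spectrum_in P F -> exists2 t : trigpoly,
  (forall u, u \in t -> P u.2) & forall theta, complex.Re (F theta) = tpval t theta.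
Proof.
move=> [t tP tF]; exists t => // theta; rewrite tF /tpval.
by apply: (big_morph _ (id1 := 0) (op1 := +%R)) => // -[? ?] [? ?].
Qed.

Lemma degree_leD D E a b : degree_le D a -> degree_le E b -> degree_le (D + E) (a + b).
Proof.
by move=> ha hb l; rewrite ffunE; have := ha l; have := hb l; move: (a l) (b l) => x y; lia.
Qed.

Lemma degree_leN D a : degree_le D a -> degree_le D (- a).
Proof. by move=> ha l; rewrite ffunE abszN. Qed.

Lemma degree_le0 D : degree_le D 0.
Proof. by move=> l; rewrite ffunE. Qed.

Lemma spectrum_mulmx P Q S n1 n2 n3 (A : 'rV[R]_p -> 'M[C]_(n1, n2))
    (B : 'rV[R]_p -> 'M[C]_(n2, n3)) :
  (forall a b, P a -> Q b -> S (a + b)) ->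
  (forall i j, spectrum_in P (fun theta => A theta i j)) ->
  (forall i j, spectrum_in Q (fun theta => B theta i j)) ->
  forall i j, spectrum_in S (fun theta => (A theta *m B theta) i j).
Proof.
move=> PQS hA hB i j.
apply: (spectrum_ext _ (fun theta => \sum_l A theta i l * B theta l j)).
  by move=> theta; rewrite mxE.
by apply: spectrum_sum => l; apply: spectrum_mul PQS (hA i l) (hB l j).
Qed.

(** The sign comes from the minus in [exp (- i theta H)]. *)
Definition spectral_freq d (H : 'I_p -> 'M[C]_d) (a : freq) : Prop :=
  forall l, eigenvalue (H l) (- a l)%:~R.

Lemma spectrum_qnnU d (H : 'I_p -> 'M[C]_d) :
  (forall l, is_hermitian (H l)) ->
  (forall l a, eigenvalue (H l) a -> exists z : int, a = z%:~R) ->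
  forall i j, spectrum_in (spectral_freq d H) (fun theta => qnnU H theta i j).
Proof.
move=> hH intH i j.
(* For the partial product over [r], coordinates outside [r] are still 0; a new factor [k] then sets
   coordinate [k] to minus an eigenvalue, once only since [r] has no repetition. *)
pose P (r : seq 'I_p) (a : freq) :=
  forall l, if l \in r then eigenvalue (H l) (- a l)%:~R : Prop else a l = 0.
pose U (r : seq 'I_p) (theta : 'rV[R]_p) : 'M[C]_d :=
  \big[(fun A B => B *m A)/1%:M]_(k <- r) evol (theta 0 k) (H k).
have hU r : uniq r -> forall i j, spectrum_in (P r) (fun theta => U r theta i j).
  elim: r => [_ {}i {}j|k r IH /= /andP[kr ur] {}i {}j].
    apply: (spectrum_ext _ (fun=> (1%:M : 'M[C]_d) i j)) => [theta|].
      by rewrite /U big_nil.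
    by apply: spectrum_cst => l; rewrite ffunE.
  apply: (spectrum_ext _ (fun theta => (U r theta *m evol (theta 0 k) (H k)) i j)) => [theta|].
    by rewrite /U big_cons.
  apply: (spectrum_mulmx (P r) (fun a => exists2 z : int,
     eigenvalue (H k) z%:~R & a = axis k (- z))) => [a _ Pa [z eig ->] l||i' j'].
  - rewrite in_cons !ffunE; have [->|lk] := eqVneq l k; last by rewrite addr0; exact: Pa.
    by have := Pa k; rewrite (negPf kr) /= => ->; rewrite add0r opprK.
  - exact: IH.
  - have [z [c [eig evE]]] := evolE d (H k) (hH k) (intH k).
    apply: (spectrum_ext _ (fun theta => \sum_l c i' j' l * char (axis k (- z l)) theta)).
      by move=> theta; rewrite evE; apply: eq_bigr => l _; rewrite char_axis.
    by apply: spectrum_sum => l; apply: spectrum_char; exists (z l).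
apply: spectrum_sub (hU _ (index_enum_uniq _) i j) => a Pa l.
by have := Pa l; rewrite mem_index_enum.
Qed.

(** In [U rho U^dagger M] the frequencies are differences of two spectral ones, as [rho] and [M]
    contribute only frequency 0; squaring the error doubles the degree bound. *)
Lemma spectrum_loss d m (H : 'I_p -> 'M[C]_d) (M : 'M[C]_d) (rho : 'I_m -> 'M[C]_d)
    (y : 'I_m -> R) (D : nat) :
  (forall l, is_hermitian (H l)) ->
  (forall l a, eigenvalue (H l) a -> exists z : int, a = z%:~R) ->
  (forall a b, spectral_freq d H a -> spectral_freq d H b -> degree_le D (a - b)) ->
  exists2 t : trigpoly, (forall u, u \in t -> degree_le (2 * D) u.2) &
    qnn_loss H M rho y = tpval t.
Proof.
move=> hH intH hD.
have hU := spectrum_qnnU d H hH intH.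
have cst n1 n2 (A : 'M[C]_(n1, n2)) i j : spectrum_in (eq 0) (fun=> A i j).
  exact: spectrum_cst.
pose out r theta : C := \tr (qnnU H theta *m rho r *m adjmx (qnnU H theta) *m M).
have out_deg r : spectrum_in (degree_le D) (out r).
  apply: spectrum_sum => i.
  apply: (spectrum_mulmx (degree_le D) (eq 0)) => [a b ha <-|{}i j|{}i j]; first by rewrite addr0.
  - apply: (spectrum_mulmx (spectral_freq d H) (fun a => spectral_freq d H (- a))) => [a b ha hb|{}i {}j|{}i {}j].
    + by rewrite -(opprK b); exact: hD.
    + apply: (spectrum_mulmx (spectral_freq d H) (eq 0)) => [a b ha <-|{}i {}j|{}i {}j].
      * by rewrite addr0.
      * exact: hU.
      * exact: cst.
    + apply: (spectrum_ext _ (fun theta => conjc (qnnU H theta j i))) => [theta|].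
        by rewrite !mxE.
      by apply: spectrum_conj (hU j i) => a; rewrite opprK.
  - exact: cst.
have add2 P F G : spectrum_in P F -> spectrum_in P G ->
    spectrum_in P (fun theta => F theta + G theta).
  move=> hF hG; apply: (spectrum_ext _ (fun theta => \sum_(b <- [:: true; false])
     (if b then F else G) theta)) => [theta|].
    by rewrite !big_cons big_nil addr0.
  by apply: spectrum_sum => -[].
have scale P z F : spectrum_in P F -> spectrum_in P (fun theta => z * F theta).
  move=> hF; apply: (spectrum_mul (eq 0) P) => //; last exact: spectrum_cst.
  by move=> a b <-; rewrite add0r.
have err_deg r : spectrum_in (degree_le D)
    (fun theta => (complex.Re (out r theta) - y r)%:C%C).
  (* Writing the real part as half of [z] plus its conjugate preserves the degree bound and lets the
     square be treated as a product of complex functions. *)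
  apply: (spectrum_ext _ (fun theta => (2^-1 : R)%:C%C * (out r theta + conjc (out r theta))
      + (- y r)%:C%C)) => [theta|].
    case: (out r theta) => a b; apply/eqP; rewrite eq_complex /=.
    by apply/andP; split; apply/eqP; field.
  apply: (add2); last by apply: spectrum_cst; exact: degree_le0.
  apply: (scale); apply: (add2) => //; apply: spectrum_conj (out_deg r); exact: degree_leN.
have [t tD tE] : exists2 t : trigpoly, (forall u, u \in t -> degree_le (2 * D) u.2) &
    forall theta, complex.Re ((qnn_loss H M rho y theta)%:C%C) = tpval t theta.
  apply: spectrum_real.
  apply: (spectrum_ext _ (fun theta => (m%:R^-1 : R)%:C%C * \sum_(r < m)
    ((complex.Re (out r theta) - y r)%:C%C * (complex.Re (out r theta) - y r)%:C%C)))
    => [theta|].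
    rewrite /qnn_loss rmorphM rmorph_sum; congr (_ * _).
    by apply: eq_bigr => r _; rewrite expr2 [RHS]rmorphM.
  apply: (scale); apply: spectrum_sum => r; apply: spectrum_mul (err_deg r) (err_deg r).
  by move=> a b ha hb; rewrite mul2n -addnn; exact: degree_leD.
by exists t => //; apply/funext.
Qed.

End LossIsTrigonometric.

(** * The bound on local minima of the loss *)

Theorem theorem4 (R : realType) (d p m : nat)
  (H : 'I_p -> 'M[R[i]]_d) (Delta : R) (M : 'M[R[i]]_d)
  (rho : 'I_m -> 'M[R[i]]_d) (y : 'I_m -> R) :
  (forall l : 'I_p, is_hermitian (H l)) ->
  (forall (l : 'I_p) (a : R[i]), eigenvalue (H l) a -> exists z : int, a = z%:~R) ->
  (forall (l : 'I_p) (a b : R[i]), eigenvalue (H l) a -> eigenvalue (H l) b ->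
      `|a - b| <= (Delta%:C)%C) ->
  is_hermitian M ->
  (0 < m)%N ->
  (forall i, density_matrix (rho i)) ->
  finite_set [set theta : 'rV[R]_p | in_period theta /\
                 critical_point (qnn_loss H M rho y) theta] ->
  forall s : seq 'rV[R]_p, uniq s ->
    (forall theta, theta \in s ->
       in_period theta /\ local_min (qnn_loss H M rho y) theta) ->
    (size s)%:R <= (4 * Delta * p%:R) ^+ p.
Proof.
move=> hH intH gapH _ m0 rhoD fin s us smin.
(* A density matrix of size 0 would have trace 0 instead of 1. *)
have d0 : (0 < d)%N.
  rewrite lt0n; apply/eqP => d0; have [_] := rhoD (Ordinal m0).
  move: (rho _); rewrite d0 => A; rewrite /mxtrace big_ord0 => /eqP.
  by rewrite eq_sym oner_eq0.
(* The gap of an eigenvalue with itself is 0; this takes some [H l], hence [p > 0]. *)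
have Delta0 (l : 'I_p) : 0 <= Delta.
  have [z [_ [eig _]]] := evolE d (H l) (hH l) (intH l).
  have := gapH l _ _ (eig (Ordinal d0)) (eig (Ordinal d0)).
  by rewrite subrr normr0 lecR.
(* Eigenvalue gaps are integers, so they are bounded by the integer part of [Delta]. *)
pose D := Num.truncn Delta.
have [t tD lossE] : exists2 t, (forall u, u \in t -> degree_le (2 * D) u.2) &
    qnn_loss H M rho y = tpval t.
  apply: spectrum_loss => // a b ha hb l.
  have := gapH l _ _ (ha l) (hb l).
  rewrite -intrB -intr_norm -(rmorph_int (real_complex R)) lecR => hab.
  rewrite !ffunE /D truncn_ge_nat; last exact: (Delta0 l).
  by apply: le_trans hab; rewrite -opprD normrN.
rewrite lossE in fin smin.
have bound : (size s <= (2 * p * (2 * D)) ^ p)%N.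
  rewrite -[size s]card_ord.
  apply: (@card_strict_minima R p _ (fun i : 'I_(size s) => nth 0 s i) t) tD => [i j /eqP|i|i].
  - by rewrite nth_uniq// => /eqP/val_inj.
  - by have [] := smin _ (mem_nth 0 (ltn_ord i)).
  - by have [] := smin _ (mem_nth 0 (ltn_ord i)); exact: finite_critical_strict.
apply: (le_trans (_ : _ <= ((2 * p * (2 * D)) ^ p)%:R)); first by rewrite ler_nat.
(* For [p = 0] the sign of [Delta] is unknown, but both sides are empty powers. *)
have [->|p0] := posnP p; first by rewrite !expr0.
have DDelta : D%:R <= Delta by rewrite truncn_le (Delta0 (Ordinal p0)).
rewrite natrX lerXn2r ?nnegrE ?ler0n ?mulr_ge0 ?ler0n ?(Delta0 (Ordinal p0))//.
by rewrite (_ : (2 * p * (2 * D) = 4 * D * p)%N) ?natrM ?ler_wpM2r ?ler_wpM2l ?ler0n//; lia.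
Qed.
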